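(* Let $\lambda\in(0,1)$. The family of dynamic conditional risk mappings $((\rho_t^x)_{t\in\mathbb{N}_0})_{x\in E}$ given, for $Z\in b\mathcal{F}$, by the value at risk $$\rho_t^x(Z)=\begin{cases}\mathrm{VaR}^x_\lambda(-Z),&t=0,\\ \mathrm{VaR}^x_\lambda(-Z\vert\mathcal{F}_t),&t\ge1,\end{cases}$$ where $$\mathrm{VaR}^x_\lambda(-Z):=\inf\{m\in\mathbb{R}:\mathbb{P}^x(m<Z)\le\lambda\},$$ $$\mathrm{VaR}^x_\lambda(-Z\vert\mathcal{F}_t):=\mathbb{P}^x\text{-}\operatorname{ess\,inf}\{m_t\in b\mathcal{F}_t:\mathbb{P}^x(m_t<Z\vert\mathcal{F}_t)\le\lambda\}\quad(t\ge1),$$ satisfies the Markov property.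
   Context: Setting. $E$ is a Polish space with Borel $\sigma$-algebra $\mathcal{E}$; $\mathbb{N}_0=\{0,1,2,\ldots\}$; $\Omega=E^{\mathbb{N}_0}$; $X_t(\omega)=\omega(t)$ is the coordinate process; $\mathcal{F}_t=\sigma(X_s: s\le t)$ and $\mathcal{F}=\sigma(\bigcup_t\mathcal{F}_t)$. $X$ is a time-homogeneous Markov chain; $x\mapsto\mathbb{P}^x$ is a measurable map from $E$ to the probability measures on $(\Omega,\mathcal{F})$, where $\mathbb{P}^x$ is the law of the chain started at $x$ (so $\mathbb{P}^x(X_0=x)=1$). The shifts $\theta_t:\Omega\to\Omega$ satisfy $X_s\circ\theta_t=X_{t+s}$. $b\mathcal{G}$ denotes the bounded $\mathcal{G}$-measurable real random variables. Inequalities between random variables (such as $\mathbb{P}^x(m_t<Z\vert\mathcal{F}_t)\le\lambda$) are understood $\mathbb{P}^x$-a.s. Risk mapping on $(\Omega,\mathcal{F},\mathbb{P}^x)$: a function $\rho^x:b\mathcal{F}\to\mathbb{R}$ with $\rho^x(0)=0$; $\rho^x(Z+c)=c+\rho^x(Z)$ for $Z\in b\mathcal{F}$, $c\in\mathbb{R}$; and $Z\le Z'$ $\mathbb{P}^x$-a.s. implies $\rho^x(Z)\le\rho^x(Z')$. Conditional risk mapping on $(\Omega,\mathcal{F},\mathbb{P}^x)$ with respect to $\mathcal{F}_t$: a function $\rho^x_t:b\mathcal{F}\to b\mathcal{F}_t$ with $\rho_t^x(0)=0$ $\mathbb{P}^x$-a.s.; $\rho_t^x(Z+Z')=Z'+\rho_t^x(Z)$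 $\mathbb{P}^x$-a.s. for $Z\in b\mathcal{F}$, $Z'\in b\mathcal{F}_t$; and $Z\le Z'$ $\mathbb{P}^x$-a.s. implies $\rho_t^x(Z)\le\rho_t^x(Z')$ $\mathbb{P}^x$-a.s. Dynamic conditional risk mapping on $(\Omega,\mathcal{F},(\mathcal{F}_t),\mathbb{P}^x)$: a sequence $(\rho_t^x)_{t\in\mathbb{N}_0}$ where $\rho_0^x$ is a risk mapping and, for $t\ge1$, $\rho_t^x$ is a conditional risk mapping with respect to $\mathcal{F}_t$. Write $\rho^x:=\rho_0^x$. Regularity: $(\rho^x)_{x\in E}$ is regular if for all $Z\in b\mathcal{F}$ the map $x\mapsto\rho^x(Z)$ is bounded and measurable. Markov property: a family $\varrho=((\rho_t^x)_{t\in\mathbb{N}_0})_{x\in E}$ of dynamic conditional risk mappings satisfies the Markov property (is Markovian) if $(\rho^x_0)_{x\in E}$ is regular and for each $x\in E$, $Z\in b\mathcal{F}$, $t\in\mathbb{N}_0$: $\rho_t^x(Z\circ\theta_t)=\rho^{X_t}(Z)$ $\mathbb{P}^x$-a.s., where $\rho^{X_t}(Z)$ is $\omega\mapsto\rho^{X_t(\omega)}(Z)$. *)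

(* Defs.v *)
From HB Require Import structures.
From mathcomp Require Import all_boot all_order all_algebra.
From mathcomp Require Import all_classical all_reals all_analysis.
From mathcomp Require Import measurable_realfun.

Set Implicit Arguments.
Unset Strict Implicit.
Unset Printing Implicit Defensive.

Import Order.TTheory GRing.Theory Num.Theory.
Import numFieldNormedType.Exports.

Local Open Scope classical_set_scope.
Local Open Scope ring_scope.

(* A complete uniform structure induced by a real-valued pseudometric is a
   complete metric as soon as the space is Hausdorff. *)
Definition polish (R : realType) (E : completePseudoMetricType R) : Prop :=
  hausdorff_space E /\ exists2 D : set E, countable D & dense D.

Definition borel (E : ptopologicalType) := g_sigma_algebraType (@open E).

(* The measurable space (E^N, F_t), with F_t = sigma(X_s : s <= t). *)
Definition past (E : ptopologicalType) (t : nat) :=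
  g_sigma_algebraType
    (\bigcup_(s in [set s : nat | (s <= t)%N])
       preimage_set_system [set: nat -> E] (fun w : nat -> E => w s)
         (@measurable _ (borel E))).

(* The measurable space (E^N, F), with F generated by the union of the F_t;
   as types, paths E and every past E t are nat -> E. *)
Definition paths (E : ptopologicalType) :=
  g_sigma_algebraType
    (\bigcup_t (@measurable _ (past E t) : set (set (nat -> E)))).

Definition path_shift (E : ptopologicalType) (t : nat) (w : paths E) : paths E :=
  fun s => w (t + s)%N.

(* [bounded_measurable Z] with Z typed over [past E t] rather than [paths E]
   means that Z belongs to bF_t rather than to bF. *)
Definition bounded_measurable (R : realType) d (T : measurableType d)
    (Z : T -> R) : Prop :=
  measurable_fun [set: T] Z /\ bounded_fun Z.

Definition bF (R : realType) (E : ptopologicalType) : set (paths E -> R) :=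
  [set Z | bounded_measurable Z].

Definition bFt (R : realType) (E : ptopologicalType) (t : nat) :
    set (paths E -> R) :=
  [set Z | bounded_measurable (Z : past E t -> R)].

Arguments bF R E : clear implicits.
Arguments bFt R E t : clear implicits.

Section fixed_law.
Context (R : realType) (E : ptopologicalType).
Variable P : {measure set (paths E) -> \bar R}.

(* Y is a version of P(A | F_t). *)
Definition cond_prob_version (t : nat) (A : set (paths E)) (Y : paths E -> R) :
    Prop :=
  [/\ measurable_fun [set: past E t] (Y : past E t -> R),
      P.-integrable [set: paths E] (EFin \o Y)
    & forall B : set (paths E), @measurable _ (past E t) B ->
        (\int[P]_(w in B) (Y w)%:E)%E = P (A `&` B)].

(* P(A | F_t) <= c, P-a.s. *)
Definition cond_prob_le (t : nat) (A : set (paths E)) (c : R) : Prop :=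
  exists2 Y, cond_prob_version t A Y & {ae P, forall w, Y w <= c}.

(* Y is a version of the P-essential infimum of the family S of random
   variables (unrelated to the essential infimum of a single function). *)
Definition ess_inf_version (S : set (paths E -> R)) (Y : paths E -> \bar R) :
    Prop :=
  [/\ measurable_fun [set: paths E] Y,
      forall m, S m -> {ae P, forall w, (Y w <= (m w)%:E)%E}
    & forall Y' : paths E -> \bar R, measurable_fun [set: paths E] Y' ->
        (forall m, S m -> {ae P, forall w, (Y' w <= (m w)%:E)%E}) ->
        {ae P, forall w, (Y' w <= Y w)%E}].

(* VaR_lam(-Z). *)
Definition VaR_opp (lam : R) (Z : paths E -> R) : R :=
  inf [set m : R | (P [set w | (m < Z w)%R] <= lam%:E)%E].

(* V is a bounded F_t-measurable version of VaR_lam(-Z | F_t). *)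
Definition cond_VaR_opp_version (lam : R) (t : nat) (Z V : paths E -> R) :
    Prop :=
  bFt R E t V /\
  ess_inf_version
    [set m | bFt R E t m /\ cond_prob_le t [set w | m w < Z w] lam]
    (EFin \o V).

Definition risk_mapping (rho : (paths E -> R) -> R) : Prop :=
  [/\ rho (cst 0) = 0,
      forall Z c, bF R E Z -> rho (Z \+ cst c) = c + rho Z
    & forall Z Z', bF R E Z -> bF R E Z' ->
        {ae P, forall w, Z w <= Z' w} -> rho Z <= rho Z'].

Definition cond_risk_mapping (t : nat)
    (rho : (paths E -> R) -> (paths E -> R)) : Prop :=
  [/\ forall Z, bF R E Z -> bFt R E t (rho Z),
      {ae P, forall w, rho (cst 0) w = 0},
      forall Z Z', bF R E Z -> bFt R E t Z' ->
        {ae P, forall w, rho (Z \+ Z') w = Z' w + rho Z w}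
    & forall Z Z', bF R E Z -> bF R E Z' ->
        {ae P, forall w, Z w <= Z' w} -> {ae P, forall w, rho Z w <= rho Z' w}].

End fixed_law.

(* The data of a sequence (rho_t)_t: rho_0 is real-valued, and [risk rho t]
   stands for rho_t when t >= 1 ([risk rho 0] is not used). All maps are
   total; only their values on bF are used. *)
Record risk_sequence (R : realType) (E : ptopologicalType) := RiskSequence {
  risk0 : (paths E -> R) -> R ;
  risk : nat -> (paths E -> R) -> (paths E -> R) }.

Definition risk_at (R : realType) (E : ptopologicalType)
    (rho : risk_sequence R E) (t : nat) (Z : paths E -> R) : paths E -> R :=
  if t is 0%N then cst (risk0 rho Z) else risk rho t Z.

Definition dynamic_risk_mapping (R : realType) (E : ptopologicalType)
    (P : {measure set (paths E) -> \bar R}) (rho : risk_sequence R E) : Prop :=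
  risk_mapping P (risk0 rho) /\
  forall t, (0 < t)%N -> cond_risk_mapping P t (risk rho t).

Section families.
Context (R : realType) (E : ptopologicalType).
Variable P : R.-pker (borel E) ~> (paths E).

(* P x is the law, started from x, of a chain with one-step kernel q:
   P^x(X_{t+1} in B | F_t) = q(X_t, B). *)
Definition markov_chain : Prop :=
  (forall x : E, P x [set w : paths E | w 0%N = x] = 1%E) /\
  exists q : R.-pker (borel E) ~> (borel E),
    forall (x : E) (t : nat) (B : set (borel E)), measurable B ->
      cond_prob_version (P x) t [set w : paths E | B (w t.+1)]
        (fun w => fine (q (w t) B)).

Definition regular (rho0 : E -> (paths E -> R) -> R) : Prop :=
  forall Z, bF R E Z ->
    bounded_measurable (fun x : borel E => rho0 x Z).

Definition markovian (rho : E -> risk_sequence R E) : Prop :=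
  [/\ forall x, dynamic_risk_mapping (P x) (rho x),
      regular (fun x => risk0 (rho x))
    & forall (x : E) (Z : paths E -> R) (t : nat), bF R E Z ->
        {ae P x, forall w : paths E,
          risk_at (rho x) t (Z \o path_shift t) w = risk0 (rho (w t)) Z}].

Definition VaR_family (lam : R) (rho : E -> risk_sequence R E) : Prop :=
  forall (x : E) (Z : paths E -> R), bF R E Z ->
    risk0 (rho x) Z = VaR_opp (P x) lam Z /\
    forall t, (0 < t)%N ->
      cond_VaR_opp_version (P x) lam t Z (risk (rho x) t Z).

End families.

(* Main.v *)
(* Write [splice t w w'] for the path that follows [w] up to time [t] and then
   [w'] restarted at time [t]. By the Markov property, P^{w_t}(splice t w in A)
   is a version of P^x(A | F_t)(w). Since the infimum defining a value at risk
   is attained, VaR(-Z) <= m iff P(m < Z) <= lam, and this Galois connection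
   shows that w |-> VaR^{w_t}(-Z o splice t w) is itself in the family whose
   essential infimum is VaR^x(-Z | F_t) and bounds it from below. So it is the
   conditional value at risk, and composing with the shift, which undoes the
   splicing under P^{w_t}, gives VaR^{w_t}(-Z). *)
From HB Require Import structures.
Require Import Defs.
From mathcomp Require Import all_boot all_order all_algebra.
From mathcomp Require Import all_classical all_reals all_analysis.
From mathcomp Require Import measurable_realfun.

Set Implicit Arguments.
Unset Strict Implicit.
Unset Printing Implicit Defensive.

Import Order.TTheory GRing.Theory Num.Theory.
Import numFieldNormedType.Exports.

Local Open Scope classical_set_scope.
Local Open Scope ring_scope.

(** * Measurability on path space and splicing of paths *)

Section path_measurability.
Context (E : ptopologicalType).

Lemma past_paths_measurable t (A : set (nat -> E)) :
  @measurable _ (past E t) A -> @measurable _ (paths E) A.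
Proof. by move=> mA; apply: sub_sigma_algebra; exists t. Qed.

Lemma measurable_past_coord t s : (s <= t)%N ->
  measurable_fun [set: past E t] ((fun w => w s) : past E t -> borel E).
Proof.
move=> st _ B mB; rewrite setTI; apply: sub_sigma_algebra.
by exists s => //; exists B => //; rewrite setTI.
Qed.

Lemma past_paths_measurable_fun t d (T : measurableType d) (f : past E t -> T) :
  measurable_fun [set: past E t] f ->
  measurable_fun [set: paths E] (f : paths E -> T).
Proof.
move=> mf _ B mB; apply: (@past_paths_measurable t).
by apply: mf => //; exact: measurableT.
Qed.

Lemma measurable_paths_coord s :
  measurable_fun [set: paths E] ((fun w => w s) : paths E -> borel E).
Proof. exact: (@past_paths_measurable_fun s _ _ _ (measurable_past_coord _)). Qed.

Lemma measurable_into_past d (T : measurableType d) t (f : T -> past E t) :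
  (forall s, (s <= t)%N ->
    measurable_fun [set: T] ((fun x => f x s) : T -> borel E)) ->
  measurable_fun [set: T] f.
Proof.
move=> mf; apply: measurability => //.
move=> _ [_ [s /= st [B mB <-]] <-]; rewrite !setTI -[X in measurable X]setTI.
exact: mf.
Qed.

Lemma past_le_measurable s t (A : set (nat -> E)) : (s <= t)%N ->
  @measurable _ (past E s) A -> @measurable _ (past E t) A.
Proof.
move=> st mA.
have /(_ measurableT A mA) : measurable_fun [set: past E t] (id : past E t -> past E s).
  apply: measurable_into_past => r rs; apply: measurable_past_coord.
  exact: leq_trans st.
by rewrite setTI.
Qed.

Lemma measurable_into_paths d (T : measurableType d) (f : T -> paths E) :
  (forall s, measurable_fun [set: T] ((fun x => f x s) : T -> borel E)) ->
  measurable_fun [set: T] f.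
Proof.
move=> mf; apply: measurability => //.
move=> _ [A [t _ mA] <-].
have mft : measurable_fun [set: T] (f : T -> past E t).
  by apply: measurable_into_past => s _; exact: mf.
exact: mft.
Qed.

(** The sets that contain both or neither of [w] and [w'] form a sigma-algebra, and it contains the
    generators of F_t. *)
Lemma past_determined t (A : set (nat -> E)) (w w' : nat -> E) :
  @measurable _ (past E t) A -> (forall s, (s <= t)%N -> w s = w' s) ->
  A w -> A w'.
Proof.
move=> mA ww'.
suff : A w = A w' by move=> ->.
apply: (mA [set A | A w = A w']); split; first split => //=.
- by move=> B BE; rewrite /setD /setC /= BE.
- by move=> F FE; apply/propext; split=> -[n _ Fn]; exists n => //;
    rewrite ?FE // -FE.
- by move=> B [s /= st [C mC <-]]; rewrite /setI /preimage /= ww'.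
Qed.

Lemma past_fun_determined t d (T : measurableType d) (f : past E t -> T)
    (w w' : nat -> E) :
  (forall x : T, measurable [set x]) -> measurable_fun [set: past E t] f ->
  (forall s, (s <= t)%N -> w s = w' s) -> f w = f w'.
Proof.
move=> m1 mf ww'; apply/esym.
have mA : @measurable _ (past E t) (f @^-1` [set f w]).
  by rewrite -[X in measurable X]setTI; exact: mf.
exact: (past_determined mA ww').
Qed.

(** The value at time [t] comes from [w] and [w' 0] is discarded. The splice thus agrees with [w] up
    to [t] for every [w'], while reading [w'] from time [t] on requires [w' 0 = w t]. *)
Definition splice t (w w' : nat -> E) : nat -> E :=
  fun s => if (s <= t)%N then w s else w' (s - t)%N.

Lemma spliceE t w w' s : (s <= t)%N -> splice t w w' s = w s.
Proof. by rewrite /splice => ->. Qed.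

Lemma splice_after t w w' s : w' 0%N = w t -> (t <= s)%N ->
  splice t w w' s = w' (s - t)%N.
Proof.
rewrite /splice => w'0 ts; case: leqP => // st.
by rewrite (@anti_leq s t) ?st // subnn w'0.
Qed.

Lemma measurable_splice t :
  measurable_fun [set: past E t * paths E]
    ((fun p => splice t p.1 p.2) : past E t * paths E -> paths E).
Proof.
apply: measurable_into_paths => s; rewrite /splice; case: leqP => st.
- exact: (measurableT_comp (measurable_past_coord st) measurable_fst).
- exact: (measurableT_comp (measurable_paths_coord _) measurable_snd).
Qed.

Lemma measurable_splicer t s w :
  measurable_fun [set: past E s]
    (splice t w : past E s -> past E (t + s)).
Proof.
apply: measurable_into_past => r rts; rewrite /splice; case: leqP => st.
- exact: measurable_cst.
- by apply: measurable_past_coord; rewrite leq_subLR.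
Qed.

Lemma measurable_paths_splicer t w :
  measurable_fun [set: paths E] (splice t w : paths E -> paths E).
Proof.
apply: measurable_into_paths => r; rewrite /splice; case: leqP => st.
- exact: measurable_cst.
- exact: measurable_paths_coord.
Qed.

Lemma measurable_path_shift t : measurable_fun [set: paths E] (@path_shift E t).
Proof. by apply: measurable_into_paths => r; exact: measurable_paths_coord. Qed.

(** These intersections form a pi-system on which the one-step kernel determines the law, which
    permits induction on time. *)
Lemma past_succ_generated t : @measurable _ (past E t.+1) =
  <<s [set A `&` [set w : nat -> E | B (w t.+1)] | A in @measurable _ (past E t)
        & B in @measurable _ (borel E)] >>.
Proof.
apply/seteqP; split.
- apply: smallest_sub; first exact: smallest_sigma_algebra.
  move=> _ [s /= st [B mB <-]]; rewrite setTI; apply: sub_sigma_algebra.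
  move: st; rewrite leq_eqVlt => /predU1P[->|st].
  + by exists setT; [exact: measurableT|exists B => //; rewrite setTI].
  + exists ((fun w => w s) @^-1` B).
      by rewrite -[X in measurable X]setTI; exact: measurable_past_coord.
    by exists setT; [exact: measurableT|rewrite setIT].
- apply: smallest_sub; first exact: (@sigma_algebra_measurable _ (past E t.+1)).
  move=> _ [A mA [B mB <-]]; apply: measurableI.
    exact: past_le_measurable mA.
  rewrite -[X in measurable X]setTI.
  by apply: (measurable_past_coord (leqnn _)); [exact: measurableT|].
Qed.

End path_measurability.

(** * Kernels: precomposition and the law of a spliced path *)

Section kprecomp.
Context d d' d'' (X : measurableType d) (Y : measurableType d')
  (Z : measurableType d'') (R : realType).
Variables (f : X -> Y) (k : R.-pker Y ~> Z).

(** The proof of measurability is an argument so that the kernel structure can be attached to the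
    term itself. *)
Definition kprecomp of measurable_fun [set: X] f : X -> {measure set Z -> \bar R} :=
  fun x => k (f x).

Variable mf : measurable_fun [set: X] f.

Let measurable_kprecomp U : measurable U ->
  measurable_fun [set: X] (kprecomp mf ^~ U).
Proof. by move=> mU; exact: measurableT_comp (measurable_kernel k _ mU) mf. Qed.

HB.instance Definition _ :=
  isKernel.Build _ _ _ _ _ (kprecomp mf) measurable_kprecomp.

Let kprecomp_prob x : kprecomp mf x [set: Z] = 1%E.
Proof. exact: prob_kernel. Qed.

HB.instance Definition _ :=
  Kernel_isProbability.Build _ _ _ _ _ (kprecomp mf) kprecomp_prob.

End kprecomp.

Section splice_kernel.
Context (R : realType) (E : ptopologicalType).
Variable P : R.-pker (borel E) ~> (paths E).
Context d (X : measurableType d) (t : nat) (g : X -> past E t).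
Hypothesis mg : measurable_fun [set: X] g.

Let measurable_at : measurable_fun [set: X] ((fun x => g x t) : X -> borel E).
Proof. exact: measurableT_comp (measurable_past_coord (leqnn t)) mg. Qed.

Let measurable_splice_pair :
  measurable_fun [set: X * paths E]
    ((fun p => splice t (g p.1) p.2) : X * paths E -> paths E).
Proof.
have mgp : measurable_fun [set: X * paths E]
    ((fun p => (g p.1, p.2)) : X * paths E -> past E t * paths E).
  apply/measurable_fun_pair => /=; last exact: measurable_snd.
  exact: measurableT_comp mg measurable_fst.
exact: (measurableT_comp (@measurable_splice E t) mgp).
Qed.

(* The law of [splice t (g x)] under P^{g x t}; the parameter [g] lets the past
   be read off F_t or off a product space. *)
Definition splice_kernel : R.-sfker X ~> paths E :=
  mkcomp (kprecomp P measurable_at) (kdirac measurable_splice_pair).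

Lemma integral_splice_kernel x (f : paths E -> \bar R) :
  (forall w, (0 <= f w)%E) -> measurable_fun [set: paths E] f ->
  (\int[splice_kernel x]_w f w = \int[P (g x t)]_w f (splice t (g x) w))%E.
Proof.
move=> f0 mf; rewrite /splice_kernel /= /mkcomp integral_kcomp//.
rewrite /kprecomp /kdirac /=; apply: eq_integral => w _.
by rewrite integral_dirac// diracT mul1e.
Qed.

Lemma splice_kernelE x A : measurable A ->
  splice_kernel x A = P (g x t) (splice t (g x) @^-1` A).
Proof.
move=> mA.
have mA' : @measurable _ (paths E) (splice t (g x) @^-1` A).
  by rewrite -[X in measurable X]setTI; exact: measurable_paths_splicer.
have := @integral_splice_kernel x (EFin \o \1_A).
rewrite /comp integral_indic// setIT => ->//.
- under eq_integral do rewrite -[\1_A _]/(\1_(splice t (g x) @^-1` A) _).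
  by rewrite integral_indic// setIT.
- exact/measurable_EFinP/measurable_indic.
Qed.

End splice_kernel.

(** * Equality of laws on path space, one time step after another *)

Section equality_on_past.
Context (R : realType) (E : ptopologicalType).
Variables mu nu : {measure set (paths E) -> \bar R}.

(** Pushed forward along the identity from F to F_t, the two measures coincide, and the integrals
    can be computed there. *)
Lemma integral_eq_past t (C : set (nat -> E)) (f : past E t -> \bar R) :
  (forall A, @measurable _ (past E t) A -> mu A = nu A) ->
  @measurable _ (past E t) C -> measurable_fun [set: past E t] f ->
  (forall w, (0 <= f w)%E) ->
  (\int[mu]_(w in C) f w = \int[nu]_(w in C) f w)%E.
Proof.
move=> munu mC mf f0.
have mid : measurable_fun [set: paths E] (id : paths E -> past E t).
  exact: past_paths_measurable_fun (@measurable_id _ (past E t) _).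
have mfC : @measurable_fun _ _ (past E t) _ C f by exact: measurable_funTS.
have transfer (m : {measure set (paths E) -> \bar R}) :
    (\int[pushforward m (id : paths E -> past E t)]_(w in C) f w =
     \int[m]_(w in C) f w)%E.
  by rewrite (ge0_integral_pushforward mid m mC mfC).
rewrite -2!transfer; apply: eq_measure_integral => A mA _.
exact: munu.
Qed.

(** Uniqueness of finite measures on a pi-system is used twice: to pass from F_s to F_{s+1}, and to
    pass from all the F_s to F. The one-step hypothesis may itself assume equality on F_s, so that
    integrals of F_s-measurable functions can be exchanged in it. *)
Lemma eq_measure_by_past t :
  (mu [set: paths E] < +oo)%E ->
  (forall A, @measurable _ (past E t) A -> mu A = nu A) ->
  (forall s A B, (t <= s)%N -> @measurable _ (past E s) A ->
    @measurable _ (borel E) B ->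
    (forall C, @measurable _ (past E s) C -> mu C = nu C) ->
    mu (A `&` [set w : nat -> E | B (w s.+1)]) =
    nu (A `&` [set w : nat -> E | B (w s.+1)])) ->
  forall A, @measurable _ (paths E) A -> mu A = nu A.
Proof.
move=> mufin munut step.
have unique (G : set (set (paths E))) : G `<=` @measurable _ (paths E) ->
    G setT -> setI_closed G -> (forall A, G A -> mu A = nu A) ->
    forall A, <<s G >> A -> mu A = nu A.
  move=> Gm GT GI munu; apply: (@g_sigma_algebra_measure_unique _ _ _ G Gm (cst setT)) => //.
  by rewrite bigcup_const.
have munu s : forall A, @measurable _ (past E s) A -> mu A = nu A.
  have [st A mA|/ltnW ts] := leqP s t.
    by apply: munut; exact: past_le_measurable mA.
  (* Induction on the time elapsed since [t]. *)
  rewrite -(subnKC ts); elim: (s - t)%N => [|n IH]; first by rewrite addn0.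
  rewrite addnS past_succ_generated; apply: unique.
  - move=> _ [A mA [B mB <-]]; apply: measurableI.
      exact: past_paths_measurable mA.
    rewrite -[X in measurable X]setTI.
    by apply: (@measurable_paths_coord E (t + n).+1) => //; exact: measurableT.
  - exists setT; first exact: measurableT.
    by exists setT; [exact: measurableT|rewrite setIT].
  - move=> _ _ [A mA [B mB <-]] [A' mA' [B' mB' <-]].
    exists (A `&` A'); first exact: measurableI.
    by exists (B `&` B'); [exact: measurableI|rewrite setIACA].
  - by move=> _ [A mA [B mB <-]]; apply: step => //; exact: leq_addr.
(* The F_s increase with [s], so their union is a pi-system; it generates F. *)
apply: unique.
- by move=> A [s _]; exact: past_paths_measurable.
- by exists 0%N => //; exact: measurableT.
- move=> A B [s _ mA] [r _ mB]; exists (maxn s r) => //; apply: measurableI.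
    by apply: past_le_measurable mA; exact: leq_maxl.
  by apply: past_le_measurable mB; exact: leq_maxr.
- by move=> A [s _]; exact: munu.
Qed.

End equality_on_past.

(** * From the one-step Markov property to the law of the whole future *)

Lemma borel_measurable_set1 (E : ptopologicalType) (x : E) :
  hausdorff_space E -> @measurable _ (borel E) [set x].
Proof.
move=> hE; rewrite -(setCK [set x]); apply: measurableC.
apply: sub_sigma_algebra; apply: closed_openC.
exact/accessible_closed_set1/hausdorff_accessible.
Qed.

Lemma measure1_ae d (T : measurableType d) (R : realType)
    (mu : {measure set T -> \bar R}) (A : set T) : measurable A ->
  mu [set: T] = 1%E -> mu A = 1%E -> {ae mu, forall w, A w}.
Proof.
move=> mA muT muA; exists (~` A); split => //; first exact: measurableC.
rewrite -setTD measureD//; first by rewrite setTI /= muT muA subee.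
by rewrite /= muT ltry.
Qed.

Section markov_chain_theory.
Context (R : realType) (E : ptopologicalType).
Variable P : R.-pker (borel E) ~> (paths E).
Hypotheses (hE : hausdorff_space E) (hP : markov_chain P).

Lemma path_lawT (x : E) : P x [set: paths E] = 1%E.
Proof. exact: prob_kernel. Qed.

(** Points are closed in a Hausdorff space, so the event is measurable and its probability one
    becomes an almost sure statement. *)
Lemma starting_point_ae (x : E) : {ae P x, forall w : paths E, w 0%N = x}.
Proof.
have mS : @measurable _ (paths E) [set w : paths E | w 0%N = x].
  have := @measurable_paths_coord E 0 measurableT _ (borel_measurable_set1 x hE).
  by rewrite setTI.
exact: (measure1_ae mS (path_lawT x) (hP.1 x)).
Qed.

(* Both sides are laws that agree on F_t and that are Markovian with the same
   one-step kernel from time t on. *)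
Lemma path_law_splice (x : E) t A : @measurable _ (paths E) A ->
  (\int[P x]_w P (w t) (splice t w @^-1` A))%E = P x A.
Proof.
move=> mA.
(* Composition of kernels passes the pair of starting point and path to the second kernel; the past
   is read off the path. *)
have msnd : measurable_fun [set: borel E * paths E]
    (snd : borel E * paths E -> past E t).
  apply: measurable_into_past => s _.
  exact: measurableT_comp (@measurable_paths_coord E s) measurable_snd.
pose K := splice_kernel P msnd.
(* The law of a path run under P^x up to time [t] and then restarted from its value there. *)
pose M : {measure set (paths E) -> \bar R} := (P \; K)%E x.
have ME B : @measurable _ (paths E) B ->
    M B = (\int[P x]_w P (w t) (splice t w @^-1` B))%E.
  by move=> mB; apply: eq_integral => w _; exact: splice_kernelE.
rewrite -ME//; apply/esym; move: A mA.
have [q hq] := hP.2.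
apply: (eq_measure_by_past (t := t)).
- by rewrite path_lawT ltry.
- move=> B mB; rewrite ME; last exact: past_paths_measurable mB.
  transitivity (\int[P x]_w (\1_B w)%:E)%E.
    by rewrite integral_indic ?setIT//; exact: past_paths_measurable mB.
  apply: eq_integral => w _; rewrite indicE.
  (* Splicing does not change the path up to [t], so the preimage of an event of F_t is everything
     or empty. *)
  have [/set_mem Bw|/negP Bw] := boolP (w \in B).
    rewrite (_ : _ @^-1` _ = setT) ?prob_kernel//.
    apply/seteqP; split => // w' _ /=.
    apply: past_determined mB _ Bw => s st; exact/esym/spliceE.
  rewrite (_ : _ @^-1` _ = set0) ?measure0//.
  apply/seteqP; split => // w' /= Bw'; apply: Bw; apply/mem_set.
  by apply: past_determined mB _ Bw' => s; exact: spliceE.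
move=> s B C ts mB mC agree.
pose h : past E s -> \bar R := fun w => (fine (q (w s) C))%:E.
have mh : measurable_fun [set: past E s] h.
  apply/measurable_EFinP; case: (hq x s C mC) => //.
have h0 w : (0 <= h w)%E by rewrite lee_fin fine_ge0.
have pm y r D : @measurable _ (past E r) D ->
    P y (D `&` [set w : nat -> E | C (w r.+1)]) =
    (\int[P y]_(w in D) (fine (q (w r) C))%:E)%E.
  by move=> mD; case: (hq y r C mC) => _ _ ->//; rewrite setIC.
have mBp : @measurable _ (paths E) B by exact: past_paths_measurable mB.
(* The one-step property turns the left side into an integral of an F_s-measurable function, in
   which P^x may be replaced by [M]; both sides then become iterated integrals, compared for each
   [w]. *)
rewrite pm// (integral_eq_past agree mB mh h0) ME; last first.
  apply: measurableI => //.
  by have := @measurable_paths_coord E s.+1 measurableT _ mC; rewrite setTI.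
pose f : paths E -> \bar R := h \_ B.
have mf : measurable_fun [set: paths E] f.
  apply/(measurable_restrictT _ mBp); apply: measurable_funTS.
  exact: past_paths_measurable_fun mh.
have f0 w : (0 <= f w)%E by rewrite /f patchE; case: ifP.
transitivity (\int[M]_w f w)%E; first by rewrite integral_mkcond.
rewrite /M /mkcomp integral_kcomp//; apply: eq_integral => w _.
rewrite integral_splice_kernel//=.
have -> : splice t w @^-1` (B `&` [set w' : nat -> E | C (w' s.+1)]) =
    (splice t w @^-1` B) `&` [set w' : nat -> E | C (w' (s - t).+1)].
  by rewrite /preimage /setI /= /splice ltnNge ts /= subSn.
have mBw : @measurable _ (past E (s - t)) (splice t w @^-1` B).
  have := @measurable_splicer E t (s - t) w measurableT B.
  by rewrite setTI subnKC//; exact.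
rewrite pm// [RHS]integral_mkcond; apply: ge0_ae_eq_integral => //.
- exact: measurableT_comp mf (@measurable_paths_splicer E t w).
- apply/(measurable_restrictT _ (past_paths_measurable mBw)).
  apply: measurable_funTS; apply: (@past_paths_measurable_fun E (s - t)).
  by apply/measurable_EFinP; case: (hq x (s - t)%N C mC).
- by move=> w' _; rewrite erestrict_ge0// => ? _; rewrite lee_fin fine_ge0.
(* The case that needs [w' 0 = w t] is [s = t]: one integrand reads [w t], the other [w' 0]. *)
apply: filterS (starting_point_ae (w t)) => w' w'0 _.
rewrite /f !patchE.
have -> : (splice t w w' \in B) = (w' \in splice t w @^-1` B).
  by apply/idP/idP => /set_mem ?; exact/mem_set.
by case: ifP => // _; rewrite /h splice_after.
Qed.

(** This is measurability of [splice_kernel] in its parameter, the past being read off F_t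
    itself. *)
Lemma measurable_path_law_splice t A : @measurable _ (paths E) A ->
  measurable_fun [set: past E t]
    ((fun w => P (w t) (splice t w @^-1` A)) : past E t -> \bar R).
Proof.
move=> mA; pose K := splice_kernel P (@measurable_id _ (past E t) setT).
apply: eq_measurable_fun (measurable_kernel K A mA) => w _.
exact: splice_kernelE.
Qed.

Lemma path_law_fin_num (x : E) A : @measurable _ (paths E) A ->
  P x A \is a fin_num.
Proof. exact: finite_kernel_measure. Qed.

Lemma splice_preimage_measurable t w A : @measurable _ (paths E) A ->
  @measurable _ (paths E) (splice t w @^-1` A).
Proof.
by move=> mA; have := @measurable_paths_splicer E t w measurableT A mA;
  rewrite setTI.
Qed.

(** For [B] in F_t the spliced path lies in [B] exactly when [w] does, so [path_law_splice] applied
    to the intersection of [A] and [B] is the defining identity. *)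
Lemma cond_prob_splice (x : E) t A : @measurable _ (paths E) A ->
  cond_prob_version (P x) t A
    (fun w => fine (P (w t) (splice t w @^-1` A))).
Proof.
move=> mA.
have fin (w : nat -> E) : P (w t) (splice t w @^-1` A) \is a fin_num.
  by apply: path_law_fin_num; exact: splice_preimage_measurable.
have mY := @measurable_path_law_splice t A mA.
split.
- exact: measurableT_comp mY.
- apply/integrableP; split.
    apply/measurable_EFinP; apply: (@past_paths_measurable_fun E t).
    exact: measurableT_comp mY.
  under eq_integral do rewrite /= ger0_norm ?fine_ge0// fineK//.
  by rewrite path_law_splice// ltey_eq path_law_fin_num.
move=> B mB; under eq_integral do rewrite fineK//.
rewrite -(@path_law_splice x t); last first.
  by apply: measurableI => //; exact: past_paths_measurable mB.
rewrite integral_mkcond; apply: eq_integral => w _.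
rewrite patchE preimage_setI; case: ifP => [/set_mem|/negbT/negP] Bw.
  rewrite (_ : splice t w @^-1` B = setT) ?setIT//.
  apply/seteqP; split => // w' _ /=.
  by apply: past_determined mB _ Bw => s st; exact/esym/spliceE.
rewrite (_ : splice t w @^-1` B = set0) ?setI0 ?measure0//.
apply/seteqP; split => // w' /= Bw'; apply: Bw; apply/mem_set.
by apply: past_determined mB _ Bw' => s; exact: spliceE.
Qed.

End markov_chain_theory.

(** * Quantiles of bounded random variables *)

Lemma bounded_fun_exP (R : realType) (T : Type) (f : T -> R) :
  bounded_fun f <-> exists M : R, forall x, `|f x| <= M.
Proof.
split=> [/pinfty_ex_gt0[M _ fM]|[M fM]]; first by exists M => x; exact: fM.
exists M; split => [|N MN x _]; first exact: num_real.
exact: le_trans (fM x) (ltW MN).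
Qed.

Lemma measurable_gt_set d (T : measurableType d) (R : realType) (Z : T -> R) m :
  measurable_fun [set: T] Z -> measurable [set w | m < Z w].
Proof.
move=> mZ; have := mZ measurableT _ (measurable_itv `]m, +oo[).
rewrite setTI; congr measurable.
by apply/seteqP; split => w /=; rewrite in_itv /= andbT.
Qed.

Lemma measurable_fun_gt_set d (T : measurableType d) (R : realType) (Z : T -> R) :
  (forall m, measurable [set w | m < Z w]) -> measurable_fun [set: T] Z.
Proof.
move=> mZ; apply: (measurability _ (RGenOInfty.measurableE R)).
move=> _ [_ [m ->] <-]; rewrite setTI; move: (mZ m); congr measurable.
by apply/seteqP; split => w /=; rewrite in_itv /= andbT.
Qed.

Lemma le_measure_ae d (T : measurableType d) (R : realType)
    (mu : {measure set T -> \bar R}) (A B : set T) :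
  measurable A -> measurable B -> {ae mu, forall w, A w -> B w} ->
  (mu A <= mu B)%E.
Proof.
move=> mA mB [N [mN muN NAB]].
have AB : A `<=` B `|` N.
  move=> w Aw; have [Bw|nBw] := pselect (B w); [by left|right].
  by apply: NAB => /= /(_ Aw).
apply: (le_trans (le_measure mu _ _ AB)); rewrite ?inE//.
  exact: measurableU.
by apply: (le_trans (measureU2 mu mB mN)); rewrite /= muN adde0.
Qed.

Section upper_quantile.
Context d (T : measurableType d) (R : realType).
Variables (mu : {measure set T -> \bar R}) (lam : R).
Hypotheses (mu1 : mu [set: T] = 1%E) (lam0 : 0 < lam) (lam1 : lam < 1).

(** The formula of [VaR_opp] over an arbitrary measurable space; for a probability it is the
    left-continuous quantile of [Z] at level [1 - lam]. *)
Definition upper_quantile (Z : T -> R) : R :=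
  inf [set m : R | (mu [set w | (m < Z w)%R] <= lam%:E)%E].

Lemma upper_quantile_has_inf (Z : T -> R) (M : R) : (forall w, `|Z w| <= M) ->
  (forall m, (mu [set w | (m < Z w)%R] <= lam%:E)%E -> - M <= m) /\
  (mu [set w | (M < Z w)%R] <= lam%:E)%E.
Proof.
move=> ZM; split=> [m|].
  rewrite [X in _ -> is_true X]leNgt; apply: contraTN => mM.
  rewrite (_ : [set w | m < Z w] = setT).
    by rewrite mu1 -ltNge lte_fin.
  apply/seteqP; split => // w _ /=; apply: lt_le_trans mM _.
  by have := ZM w; rewrite ler_norml => /andP[].
rewrite (_ : [set w | M < Z w] = set0) ?measure0 ?lee_fin ?ltW//.
apply/seteqP; split => // w /=; apply/negP; rewrite -leNgt.
exact: le_trans (ler_norm _) (ZM w).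
Qed.

(** The infimum [q] is attained by continuity from below: the event [q < Z] is the increasing union
    of the events [q + 1/(n+1) < Z], each of mass at most [lam] because admissible levels are closed
    upwards. *)
Lemma upper_quantile_le Z m : bounded_measurable Z ->
  (upper_quantile Z <= m) = (mu [set w | (m < Z w)%R] <= lam%:E)%E.
Proof.
move=> [mZ /bounded_fun_exP[M ZM]].
have [lbM MS] := upper_quantile_has_inf ZM.
set S := [set m : R | (mu [set w | (m < Z w)%R] <= lam%:E)%E] in lbM MS *.
have hS : has_inf S by split; [exists M|exists (- M)].
have Sup a b : S a -> a <= b -> S b.
  move=> Sa ab; apply: le_trans Sa; apply: le_measure; rewrite ?inE.
  - exact: measurable_gt_set.
  - exact: measurable_gt_set.
  - by move=> w /=; exact: le_lt_trans.
apply/idP/idP => [qm|]; last first.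
  by move=> Sm; apply: ge_inf => //; exact: hS.2.
apply: (Sup _ _ _ qm); rewrite /S /=.
pose F n := [set w | upper_quantile Z + n.+1%:R^-1 < Z w].
have FE : [set w | upper_quantile Z < Z w] = \bigcup_n F n.
  apply/seteqP; split => [w /= qZ|w [n _] /=]; last first.
    by apply: le_lt_trans; rewrite lerDl.
  have : 0 < Z w - upper_quantile Z by rewrite subr_gt0.
  move=> /ltr_add_invr[n]; rewrite add0r => hn; exists n => //.
  by rewrite /F /= -ltrBrDl.
have mF n : measurable (F n) by exact: measurable_gt_set.
have ndF : nondecreasing_seq F.
  move=> i j ij; apply/subsetPset => w /=; apply: le_lt_trans.
  by rewrite lerD2l lef_pV2 ?posrE// ler_nat.
have := nondecreasing_cvg_mu mF (bigcupT_measurable _ mF) ndF (mu := mu).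
rewrite -FE => cvF; rewrite -(cvg_lim _ cvF)//; apply: lime_le.
  by apply/cvg_ex; eexists; exact: cvF.
apply: nearW => n /=.
have n0 : (0 : R) < n.+1%:R^-1 by [].
have [a Sa aq] := inf_adherent n0 hS.
exact: (Sup _ _ Sa (ltW aq)).
Qed.

Lemma upper_quantile_bound (Z : T -> R) (M : R) : measurable_fun [set: T] Z ->
  (forall w, `|Z w| <= M) -> `|upper_quantile Z| <= M.
Proof.
move=> mZ ZM; have [lbM MS] := upper_quantile_has_inf ZM.
have bZ : bounded_measurable Z by split => //; apply/bounded_fun_exP; exists M.
rewrite ler_norml upper_quantile_le// MS andbT.
by apply: lbM; rewrite -upper_quantile_le.
Qed.

(** The constant [c] covers monotonicity and translation at once. By the Galois connection it
    suffices that [q + c < Z] almost surely implies [q < Z'], where [q] is the quantile of [Z']. *)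
Lemma ae_le_upper_quantile Z Z' c : bounded_measurable Z -> bounded_measurable Z' ->
  {ae mu, forall w, Z w <= Z' w + c} ->
  upper_quantile Z <= upper_quantile Z' + c.
Proof.
move=> bZ bZ' ZZ'; rewrite upper_quantile_le//.
apply: (@le_trans _ _ (mu [set w | upper_quantile Z' < Z' w])); last first.
  by rewrite -upper_quantile_le.
apply: le_measure_ae.
- exact: measurable_gt_set bZ.1.
- exact: measurable_gt_set bZ'.1.
apply: filterS ZZ' => w Zw /= qZ; rewrite -(ltrD2r c).
exact: lt_le_trans Zw.
Qed.

Lemma ae_eq_upper_quantile Z Z' c : bounded_measurable Z -> bounded_measurable Z' ->
  {ae mu, forall w, Z w = Z' w + c} ->
  upper_quantile Z = upper_quantile Z' + c.
Proof.
move=> bZ bZ' ZZ'; apply/eqP; rewrite eq_le; apply/andP; split.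
  by apply: ae_le_upper_quantile => //; apply: filterS ZZ' => w ->.
rewrite -lerBrDr; apply: ae_le_upper_quantile => //.
by apply: filterS ZZ' => w ->; rewrite addrK.
Qed.

Lemma upper_quantile0 : upper_quantile (cst 0) = 0.
Proof.
apply/eqP; rewrite -normr_le0; apply: upper_quantile_bound => // w.
by rewrite normr0.
Qed.

End upper_quantile.

(** By the Galois connection, the quantile exceeds [m] exactly when the mass of [m < Z x] exceeds
    [lam]. *)
Lemma measurable_upper_quantile d d' (X : measurableType d)
    (T : measurableType d') (R : realType) (lam : R)
    (k : X -> {measure set T -> \bar R}) (Z : X -> T -> R) :
  0 < lam -> lam < 1 ->
  (forall x, k x [set: T] = 1%E) -> (forall x, bounded_measurable (Z x)) ->
  (forall m, measurable_fun [set: X] (fun x => k x [set w | m < Z x w])) ->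
  measurable_fun [set: X] (fun x => upper_quantile (k x) lam (Z x)).
Proof.
move=> lam0 lam1 k1 bZ mk; apply: measurable_fun_gt_set => m.
rewrite (_ : [set _ | _] =
  setT `&` [set x | (lam%:E < k x [set w | (m < Z x w)%R])%E]).
  by apply: emeasurable_fun_o_infty => //; exact: mk.
rewrite setTI; apply/seteqP; split => x /=.
  by rewrite !ltNge upper_quantile_le// leNgt.
by rewrite !ltNge upper_quantile_le// leNgt.
Qed.

(** * The conditional quantile as conditional value at risk *)

Lemma ae_eq_of_integral_preimage d d' (T : measurableType d)
    (S : measurableType d') (R : realType) (mu : {measure set T -> \bar R})
    (phi : T -> S) (f g : S -> \bar R) :
  measurable_fun [set: T] phi ->
  measurable_fun [set: S] f -> measurable_fun [set: S] g ->
  mu.-integrable [set: T] (f \o phi) -> mu.-integrable [set: T] (g \o phi) ->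
  (forall B, measurable B ->
    \int[mu]_(x in phi @^-1` B) f (phi x) =
    \int[mu]_(x in phi @^-1` B) g (phi x))%E ->
  {ae mu, forall x, f (phi x) = g (phi x)}.
Proof.
move=> mphi mf mg intf intg fg.
have intS h (B : set S) : measurable B -> mu.-integrable setT (h \o phi) ->
    mu.-integrable (phi @^-1` B) (h \o phi).
  move=> mB; apply: integrableS => //.
  by rewrite -[X in measurable X]setTI; exact: mphi.
(* Under the image measure on [S], equal integrals over all measurable sets force almost everywhere
   equality; the exceptional set is pulled back along [phi]. *)
have ip := integrable_pushforward mphi mf (intS f _ measurableT intf) measurableT.
have/(_ mphi ip mg)[B _ mB|N [mN N0 sub]] :=
  @integral_ae_eq _ S R (pushforward mu phi) setT measurableT g f.
  by rewrite !(integral_pushforward mphi) ?fg//; exact: intS.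
exists (phi @^-1` N); split => //.
  by have := mphi measurableT N mN; rewrite setTI.
by move=> x /= nfg; apply: sub => /= /(_ I).
Qed.

Section conditional_quantile.
Context (R : realType) (E : ptopologicalType).
Variables (P : R.-pker (borel E) ~> (paths E)) (lam : R).
Hypotheses (hE : hausdorff_space E) (hP : markov_chain P).
Hypotheses (lam0 : 0 < lam) (lam1 : lam < 1).

(** The quantile under the regular conditional law of the path given F_t, hence a version defined at
    every [w]. *)
Definition cond_quantile t (Z : paths E -> R) : paths E -> R :=
  fun w => upper_quantile (P (w t)) lam (fun w' => Z (splice t w w')).

Let P1 : forall x : E, P x [set: paths E] = 1%E := path_lawT P.

Lemma bFt_bF t Z : bFt R E t Z -> bF R E Z.
Proof. by move=> [mZ bZ]; split => //; exact: past_paths_measurable_fun mZ. Qed.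

Lemma bF_splice t w Z : bF R E Z ->
  bounded_measurable ((fun w' => Z (splice t w w')) : paths E -> R).
Proof.
move=> [mZ /bounded_fun_exP[M ZM]]; split.
  exact: measurableT_comp mZ (@measurable_paths_splicer E t w).
by apply/bounded_fun_exP; exists M.
Qed.

Lemma bF_shift t Z : bF R E Z -> bF R E (Z \o @path_shift E t).
Proof.
move=> [mZ /bounded_fun_exP[M ZM]]; split.
  exact: measurableT_comp mZ (@measurable_path_shift E t).
by apply/bounded_fun_exP; exists M => w; exact: ZM.
Qed.

Lemma bF_add Z Z' : bF R E Z -> bF R E Z' -> bF R E (Z \+ Z').
Proof.
move=> [mZ bZ] [mZ' bZ']; split; first exact: measurable_funD.
exact: bounded_funD.
Qed.

Lemma bF_cst (c : R) : bF R E (cst c).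
Proof. by split; [exact: measurable_cst|apply/bounded_fun_exP; exists `|c|]. Qed.

Lemma bFt_splice t Z w w' : bFt R E t Z -> Z (splice t w w') = Z w.
Proof.
move=> [mZ _]; apply: (past_fun_determined _ mZ) => // s st.
exact: spliceE.
Qed.

Lemma upper_quantile_regular :
  regular (fun x Z => upper_quantile (P x) lam Z).
Proof.
move=> Z [mZ bZ]; have [M ZM] := (bounded_fun_exP Z).1 bZ; split.
  apply: measurable_upper_quantile => //.
  by move=> m; apply: measurable_kernel; exact: measurable_gt_set.
apply/bounded_fun_exP; exists M => x.
exact: (upper_quantile_bound (P1 x) lam0 lam1 mZ ZM).
Qed.

Lemma cond_quantile_bFt t Z : bF R E Z -> bFt R E t (cond_quantile t Z).
Proof.
move=> ZF; have [mZ bZ] := ZF; have [M ZM] := (bounded_fun_exP Z).1 bZ; split.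
  apply: measurable_upper_quantile => //.
  - by move=> w; exact: bF_splice.
  move=> m; apply: (@measurable_path_law_splice _ _ P t [set w | m < Z w]).
  exact: measurable_gt_set.
apply/bounded_fun_exP; exists M => w.
exact: (upper_quantile_bound (P1 _) lam0 lam1 (bF_splice _ _ ZF).1).
Qed.

(** On all splices of [w] the F_t-measurable level [m] has the constant value [m w], so the Galois
    connection extends to random levels. *)
Lemma cond_quantile_le t Z m w : bF R E Z -> bFt R E t m ->
  (cond_quantile t Z w <= m w) =
  (P (w t) (splice t w @^-1` [set w' | (m w' < Z w')%R]) <= lam%:E)%E.
Proof.
move=> ZF mF; rewrite /cond_quantile upper_quantile_le//; last exact: bF_splice.
  congr (P _ _ <= _)%E; apply/seteqP; split => w' /=; by rewrite (bFt_splice w w' mF).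
Qed.

Lemma bF_lt_measurable Z Z' : bF R E Z -> bF R E Z' ->
  @measurable _ (paths E) [set w | Z w < Z' w].
Proof.
move=> [mZ _] [mZ' _].
have /(_ measurableT [set true]) := measurable_fun_ltr mZ mZ'.
by rewrite setTI; exact.
Qed.

(** This lets the unspecified version in [cond_prob_le] be replaced by the explicit one of
    [cond_prob_splice]. *)
Lemma cond_prob_version_ae_eq (x : E) t A Y Y' :
  cond_prob_version (P x) t A Y -> cond_prob_version (P x) t A Y' ->
  {ae P x, forall w, Y w = Y' w}.
Proof.
move=> [mY iY YA] [mY' iY' Y'A].
have mid : measurable_fun [set: paths E] (id : paths E -> past E t).
  exact: past_paths_measurable_fun (@measurable_id _ (past E t) _).
have mYe : measurable_fun [set: past E t] (EFin \o Y).
  exact/measurable_EFinP.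
have mYe' : measurable_fun [set: past E t] (EFin \o Y').
  exact/measurable_EFinP.
apply: filterS (ae_eq_of_integral_preimage mid mYe mYe' iY iY' _) => [w []//|B mB].
by rewrite YA ?Y'A.
Qed.

Lemma cond_quantile_VaR (x : E) t Z : bF R E Z ->
  cond_VaR_opp_version (P x) lam t Z (cond_quantile t Z).
Proof.
move=> ZF; have VF := cond_quantile_bFt t ZF; split => //.
(* The Galois connection with the conditional quantile itself as level, where the inequality is
   trivial. *)
have VS : cond_prob_le (P x) t [set w | cond_quantile t Z w < Z w] lam.
  have mA := bF_lt_measurable (bFt_bF VF) ZF.
  eexists; first exact: (cond_prob_splice hE hP x t mA).
  apply: nearW => w.
  rewrite -lee_fin fineK -?cond_quantile_le//.
  by apply: path_law_fin_num; exact: splice_preimage_measurable.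
split.
- by apply/measurable_EFinP; exact: (bFt_bF VF).1.
- move=> m [mF [Y vY Yle]].
  have mA := bF_lt_measurable (bFt_bF mF) ZF.
  have := cond_prob_version_ae_eq (cond_prob_splice hE hP x t mA) vY.
  apply: filterS2 Yle => w Yw Ew; rewrite lee_fin cond_quantile_le//.
  rewrite -[leLHS]fineK ?lee_fin ?Ew//.
  by apply: path_law_fin_num; exact: splice_preimage_measurable.
(* The candidate belongs to the family, so every lower bound lies below it. *)
- by move=> Y' _; exact.
Qed.

(** Each of two essential infima is a lower bound and therefore lies below the other. *)
Lemma cond_VaR_opp_unique (x : E) t Z V : bF R E Z ->
  cond_VaR_opp_version (P x) lam t Z V ->
  {ae P x, forall w, V w = cond_quantile t Z w}.
Proof.
move=> ZF [VF [mV Vle Vmax]].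
have [QF [mQ Qle Qmax]] := cond_quantile_VaR x t ZF.
apply: filterS2 (Vmax _ mQ Qle) (Qmax _ mV Vle) => w.
by rewrite !lee_fin => QV VQ; apply/eqP; rewrite eq_le VQ QV.
Qed.

End conditional_quantile.

(** * Axioms of risk mappings and the Markov property *)

Section markov_property.
Context (R : realType) (E : ptopologicalType).
Variables (P : R.-pker (borel E) ~> (paths E)) (lam : R).
Hypotheses (hE : hausdorff_space E) (hP : markov_chain P).
Hypotheses (lam0 : 0 < lam) (lam1 : lam < 1).

(** By [path_law_splice], the spliced probabilities of a null set integrate to zero; being
    nonnegative, they vanish almost surely. *)
Lemma ae_splice (x : E) t (Q : paths E -> Prop) :
  {ae P x, forall w, Q w} ->
  {ae P x, forall w : paths E,
    {ae P (w t), forall w', Q (splice t w w')}}.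
Proof.
move=> [N [mN PN NQ]].
have mNs : measurable_fun [set: paths E]
    ((fun w => P (w t) (splice t w @^-1` N)) : paths E -> \bar R).
  exact: (@past_paths_measurable_fun E t _ _ _ (measurable_path_law_splice P mN)).
have : (\int[P x]_w `|P (w t) (splice t w @^-1` N)| = 0)%E.
  rewrite -[RHS]PN -(path_law_splice hE hP x t mN).
  by apply: eq_integral => w _; rewrite gee0_abs.
move=> /(ae_eq_integral_abs _ measurableT mNs).1.
apply: filterS => w /(_ I) PN0; exists (splice t w @^-1` N); split => //.
  exact: splice_preimage_measurable.
by move=> w' /= nQ; apply: NQ.
Qed.

Lemma upper_quantile_risk_mapping (x : E) :
  risk_mapping (P x) (upper_quantile (P x) lam).
Proof.
have P1 := path_lawT P x.
split.
- exact: upper_quantile0.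
- move=> Z c ZF; rewrite addrC; apply: ae_eq_upper_quantile => //.
    by apply: bF_add => //; exact: bF_cst.
  exact: nearW.
- move=> Z Z' ZF ZF' ZZ'; rewrite -[leRHS]addr0.
  apply: ae_le_upper_quantile => //.
  by apply: filterS ZZ' => w; rewrite addr0.
Qed.

(** Normalization and translation hold at every [w]; monotonicity starts from an almost sure
    inequality, which [ae_splice] carries over to the conditional laws. *)
Lemma cond_quantile_cond_risk_mapping (x : E) t :
  cond_risk_mapping (P x) t (cond_quantile P lam t).
Proof.
split.
- by move=> Z; exact: cond_quantile_bFt.
- by apply: nearW => w; apply: upper_quantile0 => //; exact: path_lawT.
- move=> Z Z' ZF ZF'; apply: nearW => w; rewrite addrC.
  apply: ae_eq_upper_quantile => //; first exact: path_lawT.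
  + by apply: bF_splice; apply: bF_add => //; exact: bFt_bF ZF'.
  + exact: bF_splice.
  by apply: nearW => w' /=; rewrite (bFt_splice w w' ZF').
- move=> Z Z' ZF ZF' ZZ'.
  have {}ZZ' : {ae P x, forall w, Z w <= Z' w + 0}.
    by apply: filterS ZZ' => w; rewrite addr0.
  apply: filterS (ae_splice t ZZ') => w {}ZZ'.
  rewrite -[leRHS]addr0; apply: ae_le_upper_quantile => //.
  + exact: path_lawT.
  + exact: bF_splice.
  + exact: bF_splice.
Qed.

Lemma cond_quantile_shift t Z w : bF R E Z ->
  cond_quantile P lam t (Z \o @path_shift E t) w = upper_quantile (P (w t)) lam Z.
Proof.
move=> ZF; rewrite -[RHS]addr0; apply: ae_eq_upper_quantile => //.
- exact: path_lawT.
- by apply: bF_splice; exact: bF_shift.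
(* The shifted splice can differ from [w'] only at time 0, where it equals [w t], the almost sure
   starting point. *)
apply: filterS (starting_point_ae hE hP (w t)) => w' w'0 /=.
rewrite addr0; congr Z; apply/funext => s.
by rewrite /path_shift splice_after ?leq_addr// addKn.
Qed.

(** Conditional values at risk are fixed only up to null sets. The almost sure axioms survive a
    change of version; membership in bF_t has to be assumed of the new one. *)
Lemma cond_risk_mapping_ae_eq (mu : {measure set (paths E) -> \bar R}) t
    (rho rho' : (paths E -> R) -> (paths E -> R)) :
  cond_risk_mapping mu t rho ->
  (forall Z, bF R E Z -> bFt R E t (rho' Z)) ->
  (forall Z, bF R E Z -> {ae mu, forall w, rho' Z w = rho Z w}) ->
  cond_risk_mapping mu t rho'.
Proof.
move=> [rF r0 rD rM] rF' rr'; split => //.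
- by apply: filterS2 r0 (rr' _ (bF_cst E 0)) => w e0 ->.
- move=> Z Z' ZF ZF'; have ZZF := bF_add ZF (bFt_bF ZF').
  apply: filterS3 (rD _ _ ZF ZF') (rr' _ ZF) (rr' _ ZZF).
  by move=> w eD -> ->.
- move=> Z Z' ZF ZF' ZZ'.
  apply: filterS3 (rM _ _ ZF ZF' ZZ') (rr' _ ZF) (rr' _ ZF').
  by move=> w leZ -> ->.
Qed.

(** Ensures that the statement about all such families is not vacuous. *)
Lemma VaR_family_exists :
  exists rho : E -> risk_sequence R E, VaR_family P lam rho.
Proof.
exists (fun x => RiskSequence (upper_quantile (P x) lam) (cond_quantile P lam)).
by move=> x Z ZF; split=> // t _; exact: cond_quantile_VaR.
Qed.

Lemma VaR_family_markovian rho : VaR_family P lam rho -> markovian P rho.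
Proof.
move=> hrho.
have rho0 x Z : bF R E Z -> risk0 (rho x) Z = upper_quantile (P x) lam Z.
  by move=> /(hrho x)[].
have rhot x t Z : (0 < t)%N -> bF R E Z ->
    {ae P x, forall w, risk (rho x) t Z w = cond_quantile P lam t Z w}.
  move=> t0 ZF; have [_ /(_ t t0)] := hrho x Z ZF.
  exact: cond_VaR_opp_unique.
split.
- move=> x; split.
    have [r0 rD rM] := upper_quantile_risk_mapping x; split.
    + by rewrite rho0//; exact: bF_cst.
    + move=> Z c ZF; rewrite !rho0 ?rD//.
      by apply: bF_add => //; exact: bF_cst.
    + by move=> Z Z' ZF ZF' ZZ'; rewrite !rho0//; exact: rM.
  move=> t t0; apply: cond_risk_mapping_ae_eq (cond_quantile_cond_risk_mapping x t) _ _.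
    by move=> Z /(hrho x)[_ /(_ t t0)[]].
  by move=> Z; exact: rhot.
- move=> Z ZF; rewrite (_ : (fun _ => _) = fun x => upper_quantile (P x) lam Z).
    exact: upper_quantile_regular.
  by apply/funext => x; exact: rho0.
- move=> x Z [|t] ZF.
    (* At time 0 the shift is the identity by computation, and [w 0 = x] almost surely. *)
    by apply: filterS (starting_point_ae hE hP x) => w <-.
  apply: filterS (rhot x t.+1 _ isT (bF_shift t.+1 ZF)) => w /= ->.
  by rewrite cond_quantile_shift// rho0.
Qed.

End markov_property.

Theorem lemma3p3 (R : realType) (E : completePseudoMetricType R)
    (P : R.-pker (borel E) ~> (paths E)) (lam : R) :
  polish E -> markov_chain P -> 0 < lam -> lam < 1 ->
  (exists rho : E -> risk_sequence R E, VaR_family P lam rho) /\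
  (forall rho : E -> risk_sequence R E, VaR_family P lam rho -> markovian P rho).
Proof.
move=> [hE _] hP lam0 lam1; split; first exact: VaR_family_exists.
by move=> rho; exact: VaR_family_markovian.
Qed.
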